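(* Let $n\ge1$ and suppose $1\le p\le q<\infty$ and $\alpha\in\mathbb{R}$, with $\alpha\le0$ if $p=q$. Then for every cube $Q_0\subset\mathbb{R}^n$, $SR_{p,q}\log^\alpha(Q_0)=M_{n(\frac1p-\frac1q),\alpha,Q_0}L^q(Q_0)$; more precisely, $\|f\|_{SR_{p,q}\log^\alpha(Q_0)}\approx\|M_{n(\frac1p-\frac1q),\alpha,Q_0}f\|_{L^q(Q_0)}$, with constants independent of $f$ and $Q_0$.
   Context: Cubes have sides parallel to the axes; $\mathcal{D}(Q_0)$ is the family of dyadic subcubes of $Q_0$. A countable $(Q_i)_{i\in I}\subset\mathcal{D}(Q_0)$ is sparse if there exist pairwise disjoint measurable $E_{Q_i}\subseteq Q_i$ with $|E_{Q_i}|\ge\frac12|Q_i|$; $S(Q_0)$ is the set of sparse families. $(a)_-=\min\{a,0\}$, $\log$ is the natural logarithm, $p'$ is the dual exponent. $SR_{p,q}\log^\alpha(Q_0)$ is the set of $f\in L^1(Q_0)$ with $\|f\|_{SR_{p,q}\log^\alpha(Q_0)}=\sup_{(Q_i)\in S(Q_0)}\big\{\sum_i\big[(1-(\log|Q_i|)_-)^\alpha|Q_i|^{-1/p'}\int_{Q_i}|f|\big]^q\big\}^{1/q}<\infty$. For $0\le\lambda<n$, $M_{\lambda,\alpha,Q_0}f(x)=\sup_{Q\in\mathcal{D}(Q_0),\,x\in Q}|Q|^{\frac\lambda n-1}(1-(\log|Q|)_-)^\alpha\int_Q|f|$, $x\in Q_0$, and $M_{\lambda,\alpha,Q_0}L^q(Q_0)=\{f\in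 L^1(Q_0):M_{\lambda,\alpha,Q_0}f\in L^q(Q_0)\}$. *)

(* Defs.v *)
From HB Require Import structures.
From mathcomp Require Import all_boot all_order all_algebra.
From mathcomp Require Import all_classical all_reals all_analysis.
Import Order.TTheory GRing.Theory Num.Theory.
Set Implicit Arguments.
Unset Strict Implicit.
Unset Printing Implicit Defensive.
Local Open Scope classical_set_scope.
Local Open Scope ring_scope.

(* Product of two sigma-finite measures, packaged as a sigma-finite    *)
(* measure (the library only declares the sigma-finite instance of     *)
(* [\x] for subprobabilities).                                         *)
Section pmeas.
Context d1 d2 (T1 : measurableType d1) (T2 : measurableType d2) (R : realType).
Variables (m1 : {sigma_finite_measure set T1 -> \bar R})
          (m2 : {sigma_finite_measure set T2 -> \bar R}).

Definition pmeas : set (T1 * T2) -> \bar R := (m1 \x m2)%E.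

HB.instance Definition _ := Measure.on pmeas.

Lemma pmeas_sigma_finite : sigma_finite setT pmeas.
Proof.
have /sigma_finiteP[F [TF ndF Foo]] := sigma_finiteT m1.
have /sigma_finiteP[G [TG ndG Goo]] := sigma_finiteT m2.
exists (fun n => F n `*` G n).
 rewrite -setXTT TF TG predeqE => -[x y]; split.
    move=> [/= [n _ Fnx] [k _ Gky]]; exists (maxn n k) => //; split.
    - by move: x Fnx; exact/subsetPset/ndF/leq_maxl.
    - by move: y Gky; exact/subsetPset/ndG/leq_maxr.
  by move=> [n _ []/= ? ?]; split; exists n.
move=> k; have [? ?] := Foo k; have [? ?] := Goo k.
split; first exact: measurableX.
by rewrite /pmeas product_measure1E// lte_mul_pinfty// ge0_fin_numE.
Qed.

HB.instance Definition _ :=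
  Measure_isSigmaFinite.Build _ _ _ pmeas pmeas_sigma_finite.
End pmeas.

(* R^n with n-dimensional Lebesgue measure, built as the iterated      *)
(* product R * (R * ( ... * (R * unit))) of one-dimensional Lebesgue   *)
(* measures (the unit factor carries the Dirac mass, of total mass 1). *)
Record mspace (R : realType) := MSpace {
  ms_disp : measure_display;
  ms_type : measurableType ms_disp;
  ms_meas : {sigma_finite_measure set ms_type -> \bar R} }.

Fixpoint Leb (R : realType) (n : nat) : mspace R :=
  match n with
  | 0 => @MSpace R _ unit \d_tt
  | m.+1 => let S := Leb R m in
     @MSpace R _ (measurableTypeR R * ms_type S)%type
        (pmeas lebesgue_measure (ms_meas S))
  end.

Definition Rn (R : realType) (n : nat) : measurableType _ := ms_type (Leb R n).
Definition lebn (R : realType) (n : nat) : {sigma_finite_measure set (Rn R n) -> \bar R} :=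
  ms_meas (Leb R n).

Fixpoint coord (R : realType) (n : nat) : Rn R n -> nat -> R :=
  match n with
  | 0 => fun _ _ => 0
  | m.+1 => fun x i => let y : (R * Rn R m)%type := x in
     match i with 0 => y.1 | j.+1 => @coord R m y.2 j end
  end.

Section cubes.
Variables (R : realType) (n : nat).
Local Notation T := (Rn R n).
Local Notation mu := (lebn R n).

Definition cube (a : nat -> R) (l : R) : set T :=
  [set x | forall i, (i < n)%N -> a i <= coord x i < a i + l].

Definition dyadic (a : nat -> R) (l : R) : set (set T) :=
  [set Q | exists (k : nat) (j : nat -> nat),
      (forall i, (i < n)%N -> (j i < 2 ^ k)%N) /\
      Q = cube (fun i => a i + (j i)%:R * (l / 2 ^+ k)) (l / 2 ^+ k)].

Definition sparse (a : nat -> R) (l : R) (S : set (set T)) : Prop :=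
  [/\ S `<=` dyadic a l, countable S &
      exists E : set T -> set T,
        (forall Q, S Q -> [/\ measurable (E Q), E Q `<=` Q &
                             (mu Q / 2%:E <= mu (E Q))%E]) /\
        (forall Q Q', S Q -> S Q' -> Q <> Q' -> E Q `&` E Q' = set0)].

Definition vol (Q : set T) : R := fine (mu Q).

Definition logw (Q : set T) : R := 1 - Order.min (ln (vol Q)) 0.

Definition intabs (f : T -> R) (Q : set T) : R :=
  fine (\int[mu]_(x in Q) `|f x|%:E)%E.

Definition SRnorm (p q alpha : R) (a : nat -> R) (l : R) (f : T -> R) : \bar R :=
  ereal_sup [set (\esum_(Q in S)
      ((logw Q `^ alpha * vol Q `^ (- (1 - p^-1)) * intabs f Q) `^ q)%:E)
      `^ q^-1 | S in sparse a l]%E.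

Definition Mmax (lambda alpha : R) (a : nat -> R) (l : R) (f : T -> R) (x : T)
  : \bar R :=
  ereal_sup [set (vol Q `^ (lambda / n%:R - 1) * logw Q `^ alpha
                   * intabs f Q)%:E | Q in [set Q | dyadic a l Q /\ Q x]].

(* || g ||_{L^q(Q0)} for nonnegative g *)
Definition Lqnorm (q : R) (a : nat -> R) (l : R) (g : T -> \bar R) : \bar R :=
  ((\int[mu]_(x in cube a l) (g x `^ q)) `^ q^-1)%E.

End cubes.

(* Main.v *)
Require Import Defs.
From HB Require Import structures.
From mathcomp Require Import all_boot all_order all_algebra.
From mathcomp Require Import all_classical all_reals all_analysis.
From mathcomp Require Import measurable_realfun.
From mathcomp Require Import ring lra.
Import Order.TTheory GRing.Theory Num.Theory.
Local Open Scope classical_set_scope.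
Local Open Scope ring_scope.

(* With [w Q = |Q|^(1/p - 1/q - 1) logw(Q)^alpha int_Q |f|], the [q]-th power of
   a term of the sparse sum is [w(Q)^q |Q|], and the maximal function is
   [M x = sup {w Q : x in Q}].  If [E] witnesses sparsity of [S], then
   [sum_S w(Q)^q |Q| <= 2 sum_S int_(E Q) M^q <= 2 int M^q].
   Conversely, run a stopping-time argument: starting from the cube [Q0], select
   below each selected [Q] the maximal dyadic cubes [P] with [w P > 2 K w Q].
   Every dyadic cube containing [x] has [w] at most [2 K w Q] for some selected
   [Q] containing [x], so [M^q <= (2 K)^q sum_S w(Q)^q 1_Q].  The selected family
   is sparse because [w Q = phi(|Q|) int_Q |f|], where [v phi(v)] is increasing
   up to the factor [K]; this is where [alpha <= 0] is needed when [p = q]. *)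

Set Implicit Arguments.
Unset Strict Implicit.
Unset Printing Implicit Defensive.

(** * Countable families of sets: measures, integrals and suprema *)

Lemma countable_enum (T : Type) (F : set (set T)) : countable F ->
  exists (J : set nat) (e : nat -> set T), set_bij J F e.
Proof.
move=> /countable_injP[f finj].
have eK := pinvKV (fun=> set0) finj.
exists (f @` F), ('pinv_(fun=> set0) F f); split.
- by move=> _ [Q FQ <-]; rewrite eK ?inE.
- move=> _ _ /set_mem[Q FQ <-] /set_mem[Q' FQ' <-].
  by rewrite !eK ?inE// => ->.
- by move=> Q FQ; exists (f Q); [exists Q|rewrite eK ?inE].
Qed.

Lemma bigcup_enum (T : Type) (F : set (set T)) (J : set nat) e :
  set_bij J F e ->
  \bigcup_(Q in F) Q = \bigcup_i (if i \in J then e i else set0).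
Proof.
move=> [Je _ eS]; apply/seteqP; split=> x.
  move=> [Q FQ Qx]; have [i Ji eQ] := eS _ FQ.
  by exists i => //; rewrite mem_set// eQ.
by move=> [i _]; case: ifPn => // /set_mem Ji ex; exists (e i) => //; exact: Je.
Qed.

Lemma countable_bigcup_measurable d (T : measurableType d) (F : set (set T)) :
  countable F -> F `<=` measurable -> measurable (\bigcup_(Q in F) Q).
Proof.
move=> /countable_enum[J [e eJ]] Fm; rewrite (bigcup_enum eJ).
apply: bigcupT_measurable => i; case: ifPn => // /set_mem Ji.
by case: eJ => Je _ _; apply: Fm; exact: Je.
Qed.

(** Countable additivity of both sides. It serves to bound the total measure of the stopping
    children of a cube. *)
Lemma bigcup_measure_le_integral d (T : measurableType d) (R : realType)
    (mu : {measure set T -> \bar R}) (F : set (set T)) (g : T -> \bar R) :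
  countable F -> F `<=` measurable ->
  (forall Q Q', F Q -> F Q' -> Q `&` Q' !=set0 -> Q = Q') ->
  measurable_fun (\bigcup_(Q in F) Q) g ->
  (forall x, (\bigcup_(Q in F) Q) x -> 0 <= g x)%E ->
  (forall Q, F Q -> mu Q <= \int[mu]_(x in Q) g x)%E ->
  (mu (\bigcup_(Q in F) Q) <= \int[mu]_(x in \bigcup_(Q in F) Q) g x)%E.
Proof.
move=> /countable_enum[J [e eJ]] Fm Fdisj; rewrite (bigcup_enum eJ).
case: eJ => Je eI eS mg g0 Fle.
have Gm i : measurable (if i \in J then e i else set0).
  by case: ifPn => // /set_mem Ji; apply: Fm; exact: Je.
have Gt : trivIset setT (fun i => if i \in J then e i else set0).
  move=> i j _ _ []; case: ifPn => Ji x []; last by [].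
  case: ifPn => Jj eix ejx; last by [].
  apply: eI => //; apply: Fdisj; first exact/Je/set_mem.
    exact/Je/set_mem.
  by exists x.
rewrite measure_bigcup// ge0_integral_bigcup// (eq_eseriesl _ _ (@in_setT _)).
apply: lee_nneseries => // i _.
case: ifPn => [/set_mem Ji|_]; first exact/Fle/Je.
by rewrite measure0 integral_set0.
Qed.

(** The supremum at [x] is at most the sum of [h Q] over the [Q] containing [x], and this
    nonnegative series is integrated term by term. *)
Lemma integral_le_esum d (T : measurableType d) (R : realType)
    (mu : {measure set T -> \bar R}) (F : set (set T)) (D : set T)
    (g : T -> \bar R) (h : set T -> R) :
  countable F -> F `<=` measurable -> (forall Q, F Q -> Q `<=` D) ->
  measurable D -> measurable_fun D g -> (forall x, D x -> 0 <= g x)%E ->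
  (forall Q, 0 <= h Q) ->
  (forall x, D x -> (g x <= ereal_sup [set (h Q)%:E | Q in [set Q | F Q /\ Q x]])%E) ->
  (\int[mu]_(x in D) g x <= \esum_(Q in F) ((h Q)%:E * mu Q))%E.
Proof.
move=> /countable_enum[J [e eJ]] Fm FD mD mg g0 h0 gle.
pose G i := if i \in J then e i else set0.
have [Je eI eS] := eJ.
have Gm i : measurable (G i).
  by rewrite /G; case: ifPn => // /set_mem Ji; apply: Fm; exact: Je.
pose u i x := ((h (e i))%:E * (\1_(G i) x)%:E)%E.
have u0 i x : (0 <= u i x)%E by rewrite mule_ge0// lee_fin.
have mu' i : measurable_fun D (u i).
  apply: measurable_funeM; apply: measurable_funTS.
  by apply/measurable_EFinP; exact: measurable_indic.
apply: (@le_trans _ _ (\int[mu]_(x in D) \sum_(0 <= i <oo) u i x)%E).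
  apply: ge0_le_integral => //.
  - exact: ge0_emeasurable_sum.
  - move=> x Dx; apply: (le_trans (gle _ Dx)).
    apply: ge_ereal_sup => _ [Q [FQ Qx] <-].
    have [i Ji eQ] := eS _ FQ.
    have -> : ((h Q)%:E = u i x)%E.
      by rewrite /u /G mem_set// eQ indicE mem_set//= mule1.
    rewrite (nneseriesD1 (n := i))//.
    by rewrite leeDl// nneseries_ge0.
rewrite integral_nneseries//.
rewrite (@reindex_esum _ _ _ J F e)//.
rewrite esum_mkcond -nneseries_esumT; last first.
  by move=> i; case: ifPn => // _; rewrite mule_ge0// lee_fin.
apply: lee_nneseries; first by move=> *; exact: integral_ge0.
move=> i _; rewrite /u ge0_integralZl//; last 2 first.
  - by apply: measurable_funTS; apply/measurable_EFinP; exact: measurable_indic.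
  - by rewrite lee_fin.
rewrite integral_indic// /G; case: ifPn => [/set_mem Ji|_].
  rewrite setIidl//; apply: FD; exact: Je.
by rewrite set0I measure0 mule0.
Qed.

(** The sum is a supremum over finite subfamilies, so additivity over finite disjoint unions
    suffices; on each [E Q] the constant [h Q] lies below [g]. *)
Lemma esum_sparse_le_integral d (T : measurableType d) (R : realType)
    (mu : {measure set T -> \bar R}) (F : set (set T)) (D : set T)
    (E : set T -> set T) (g : T -> \bar R) (h : set T -> R) :
  (forall Q, F Q -> measurable (E Q)) -> (forall Q, F Q -> E Q `<=` D) ->
  (forall Q Q', F Q -> F Q' -> Q <> Q' -> E Q `&` E Q' = set0) ->
  measurable D -> measurable_fun D g -> (forall x, D x -> 0 <= g x)%E ->
  (forall Q, 0 <= h Q) ->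
  (forall Q x, F Q -> E Q x -> ((h Q)%:E <= g x)%E) ->
  (\esum_(Q in F) ((h Q)%:E * mu (E Q)) <= \int[mu]_(x in D) g x)%E.
Proof.
move=> Em ED Edisj mD mg g0 h0 hle.
apply: ge_ereal_sup => _ [X [Xfin XF] <-].
rewrite fsbig_finite//=.
pose G Q := if Q \in X then E Q else set0.
set s := finmap.enum_fset _.
have sX Q : Q \in s = (Q \in X) by rewrite /s in_fset_set.
have Gm Q : measurable (G Q).
  by rewrite /G; case: ifPn => // /set_mem XQ; apply: Em; exact: XF.
have GD : \big[setU/set0]_(Q <- s) G Q `<=` D.
  rewrite big_seq; elim/big_ind: _ => //; first by move=> A B AD BD x [/AD|/BD].
  move=> Q Qs; rewrite /G; case: ifPn => [/set_mem XQ|_]; last exact: sub0set.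
  by apply: ED; apply: XF.
have mU : measurable (\big[setU/set0]_(Q <- s) G Q).
  by apply: bigsetU_measurable.
apply: (@le_trans _ _ (\int[mu]_(x in \big[setU/set0]_(Q <- s) G Q) g x)%E); last first.
  exact: ge0_subset_integral.
rewrite ge0_integral_bigsetU//; last first.
- by move=> x /GD; exact: g0.
- exact: measurable_funS mg.
- move=> Q Q' /= ; rewrite !sX => XQ XQ' [x []]; rewrite /G XQ XQ' => EQ EQ'.
  apply: contrapT => QQ'; have : (E Q `&` E Q') x by [].
  by rewrite Edisj//; apply: XF; exact: set_mem.
- exact: finmap.fset_uniq.
rewrite big_seq [leRHS]big_seq; apply: lee_sum => Q; rewrite sX /G => XQ; rewrite XQ.
have FQ : F Q by apply: XF; exact: set_mem.
rewrite -integral_cst; last exact: Em.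
apply: ge0_le_integral => //=.
- exact: Em.
- by move=> x _; rewrite lee_fin.
- by apply: measurable_funS mg => //; exact: ED.
- by move=> x; exact: hle.
Qed.

(** The supremum exceeds [r] exactly on the union of the countably many [Q] with [r < h Q]. *)
Lemma measurable_fun_ereal_sup_mem d (T : measurableType d) (R : realType)
    (F : set (set T)) (D : set T) (h : set T -> R) :
  countable F -> F `<=` measurable ->
  measurable_fun D
    (fun x => ereal_sup [set (h Q)%:E | Q in [set Q | F Q /\ Q x]]).
Proof.
move=> cF Fm mD; apply: (measurability _ (ErealGenOInfty.measurableE R)) => //.
move=> /= _ [_ [r ->] <-]; apply: measurableI => //.
set f := (X in X @^-1` _).
rewrite (_ : _ @^-1` _ = \bigcup_(Q in F `&` [set Q | r < h Q]) Q).
  apply: countable_bigcup_measurable; last by move=> Q [/Fm].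
  by apply: sub_countable cF; apply: subset_card_le => Q [].
apply/seteqP; split=> x /=; rewrite in_itv/= andbT.
  by move=> /ereal_sup_gt[_ [Q [FQ Qx] <-]]; rewrite lte_fin => rQ; exists Q.
move=> [Q [FQ /= rQ] Qx]; rewrite -lte_fin in rQ.
by apply: (lt_le_trans rQ); apply: ereal_sup_ubound; exists Q.
Qed.

(** * Almost monotonicity of powers with a logarithmic factor *)

Lemma one_sub_min_ln_ge1 (R : realType) (v : R) : 1 <= 1 - Order.min (ln v) 0.
Proof. by rewrite lerDl oppr_ge0 ge_min lexx orbT. Qed.

(* For [0 < alpha] the logarithmic factor is absorbed by the power:
   [1 + ln t <= (1 + alpha / s) t ^ (s / alpha)] for [1 <= t]. *)
Lemma powR_log_almost_increasing (R : realType) (s alpha : R) :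
  0 <= s -> (s = 0 -> alpha <= 0) ->
  exists K : R, 1 <= K /\ forall u v : R, 0 < u -> u <= v ->
    u `^ s * (1 - Order.min (ln u) 0) `^ alpha <=
    K * (v `^ s * (1 - Order.min (ln v) 0) `^ alpha).
Proof.
move=> s0 sal; case: (leP alpha 0) => [al0|al0].
  (* Both factors are nondecreasing: the logarithmic one is a nonincreasing function raised to a
     nonpositive power. *)
  exists 1; split => // u v u0 uv; rewrite mul1r.
  have v0 : 0 < v by exact: lt_le_trans uv.
  apply: ler_pM; rewrite ?powR_ge0//.
    by apply: ge0_ler_powR; rewrite ?nnegrE// ltW.
  have -> : alpha = - - alpha by rewrite opprK.
  rewrite !(powRN _ (- alpha)) lef_pV2 ?posrE; last 2 first.
  - by rewrite powR_gt0// (lt_le_trans ltr01)// one_sub_min_ln_ge1.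
  - by rewrite powR_gt0// (lt_le_trans ltr01)// one_sub_min_ln_ge1.
  apply: ge0_ler_powR; rewrite ?nnegrE ?oppr_ge0//.
  - by rewrite (le_trans ler01)// one_sub_min_ln_ge1.
  - by rewrite (le_trans ler01)// one_sub_min_ln_ge1.
  rewrite lerD2l lerN2 le_min !ge_min lexx orbT andbT.
  by rewrite ler_ln ?posrE// uv.
have {s0 sal} s0 : 0 < s.
  by rewrite lt_neqAle s0 andbT; apply/eqP => /esym/sal; rewrite leNgt al0.
have as0 : 0 < alpha / s by rewrite divr_gt0.
exists ((1 + alpha / s) `^ alpha); split.
  apply: (@le_trans _ _ (1 `^ alpha)); first by rewrite powR1.
  by rewrite ge0_ler_powR ?nnegrE ?ler01 ?lerDl ?addr_ge0// ltW.
move=> u v u0 uv; have v0 : 0 < v by exact: lt_le_trans uv.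
set d := ln v - ln u.
have d0 : 0 <= d by rewrite subr_ge0 ler_ln ?posrE.
set Lu := 1 - _; set Lv := 1 - _.
have Lv1 : 1 <= Lv by exact: one_sub_min_ln_ge1.
have Lu1 : 1 <= Lu by exact: one_sub_min_ln_ge1.
have Lv0 : 0 <= Lv by exact: le_trans Lv1.
(* Taking the minimum with 0 is 1-Lipschitz, so [Lu <= Lv + d]; then [1 <= Lv] turns the sum into a
   product. *)
have LL : Lu <= Lv * (1 + d).
  apply: (@le_trans _ _ (Lv + d)).
    suff : Order.min (ln v) 0 <= Order.min (ln u) 0 + d by rewrite /Lu /Lv; lra.
    rewrite -lerBlDr le_min !lerBlDr !ge_min add0r d0 orbT andbT.
    by rewrite /d addrCA subrr addr0 lexx.
  by rewrite mulrDr mulr1 lerD2l ler_peMl.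
(* This is [1 + t <= expR t] at [t = s / alpha * d], scaled by [alpha / s]. The power [alpha] of the
   exponential is then [expR (s * d)], the ratio of [v ^ s] to [u ^ s]. *)
have Ed : 1 + d <= (1 + alpha / s) * expR (s / alpha * d).
  rewrite mulrDl mul1r; apply: lerD.
    by rewrite -[leLHS]expR0 ler_expR mulr_ge0// divr_ge0// ltW.
  have := expR_ge1Dx (s / alpha * d).
  move=> /(ler_wpM2l (ltW as0)); apply: le_trans.
  rewrite mulrDr mulr1 mulrA.
  have -> : alpha / s * (s / alpha) = 1.
    by field; rewrite !gt_eqF.
  by rewrite mul1r lerDr ltW.
have vs : v `^ s = u `^ s * expR (s * d).
  rewrite /powR !gt_eqF// -expRD -mulrDr /d; congr (expR (_ * _)).
  by rewrite addrC subrK.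
have Lpow : Lu `^ alpha <= Lv `^ alpha * ((1 + alpha / s) `^ alpha * expR (s * d)).
  have -> : expR (s * d) = expR (s / alpha * d) `^ alpha.
    by rewrite -expRM mulrAC divfK// gt_eqF.
  have as1 : 0 <= 1 + alpha / s by rewrite addr_ge0 ?ltW.
  rewrite -powRM ?expR_ge0// -powRM ?mulr_ge0 ?expR_ge0//.
  apply: ge0_ler_powR; rewrite ?nnegrE.
  - exact: ltW.
  - exact: le_trans Lu1.
  - by rewrite mulr_ge0// mulr_ge0// expR_ge0.
  - exact: (le_trans LL (ler_wpM2l Lv0 Ed)).
rewrite vs; apply: (le_trans (ler_wpM2l (powR_ge0 _ _) Lpow)).
by rewrite le_eqVlt; apply/orP; left; apply/eqP; ring.
Qed.

(** * Measurability and volume of cubes *)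

Lemma cubeS (R : realType) (n : nat) (a : nat -> R) (l : R) :
  cube (n := n.+1) a l =
  ([set` `[a 0, a 0 + l[%R] `*` cube (n := n) (a \o succn) l)%classic.
Proof.
apply/seteqP; split=> -[x y].
  move=> xy; split; first by rewrite /= in_itv/=; exact: (xy 0%N).
  by move=> i ni; exact: (xy i.+1).
move=> [/=]; rewrite in_itv/= => x0 yi [_|i ni] //=.
exact: yi.
Qed.

Lemma cube_measurable (R : realType) (n : nat) (a : nat -> R) (l : R) :
  measurable (cube (n := n) a l).
Proof.
elim: n a => [|n IH] a.
  by rewrite (_ : cube _ _ = setT)//; apply/seteqP; split.
by rewrite cubeS; apply: measurableX => //; exact: measurable_itv.
Qed.

Lemma lebn_cube (R : realType) (n : nat) (a : nat -> R) (l : R) : 0 <= l ->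
  lebn R n (cube a l) = (l ^+ n)%:E.
Proof.
move=> l0; elim: n a => [|n IH] a.
  rewrite (_ : cube _ _ = setT); last by apply/seteqP; split.
  by rewrite /lebn/= diracT expr0.
have itv : lebesgue_measure [set` `[a 0, a 0 + l[%R] = l%:E.
  rewrite lebesgue_measure_itv/= lte_fin ltrDl; case: ifPn => [_|].
    by rewrite -EFinB addrC addKr.
  by rewrite -leNgt => l0'; rewrite (@le_anti _ _ l 0) ?l0 ?l0'.
rewrite cubeS exprS EFinM -itv -(IH (a \o succn)).
by apply: product_measure1E; [exact: measurable_itv|exact: cube_measurable].
Qed.

Lemma exists_coord (R : realType) (n : nat) (g : nat -> R) :
  exists x : Rn R n, forall i, (i < n)%N -> Defs.coord x i = g i.
Proof.
elim: n g => [|n IH] g; first by exists tt.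
by have [y yE] := IH (g \o succn); exists (g 0, y) => -[|i] //= ni; exact: yE.
Qed.

(** * Dyadic cubes, indexed by a generation and a point *)

Section dyadic_cubes.
Context (R : realType) (n : nat) (a : nat -> R) (l : R).
Hypothesis l0 : 0 < l.
Implicit Types x y : Rn R n.

(** Truncation is the floor only when [a i <= coord x i], hence the membership of [x] in the base
    cube assumed below. *)
Definition dindex k x i : nat :=
  Num.truncn ((Defs.coord x i - a i) / (l / 2 ^+ k)).

(** Naming a cube by one of its points rather than by an index vector makes its ancestors the cubes
    [dcube m x] with [m <= k]. *)
Definition dcube k x : set (Rn R n) :=
  cube (fun i => a i + (dindex k x i)%:R * (l / 2 ^+ k)) (l / 2 ^+ k).

Let side_gt0 k : 0 < l / 2 ^+ k. Proof. by rewrite divr_gt0// exprn_gt0. Qed.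

Let coord_itvE k x i (j : nat) : a i <= Defs.coord x i ->
  (a i + j%:R * (l / 2 ^+ k) <= Defs.coord x i
     < a i + j%:R * (l / 2 ^+ k) + l / 2 ^+ k) = (dindex k x i == j).
Proof.
move=> ax; rewrite /dindex truncn_eq; last first.
  by rewrite divr_ge0 ?subr_ge0// ltW.
rewrite ler_pdivlMr// ltr_pdivrMr// -[j.+1%:R]natr1 mulrDl mul1r -addrA.
by rewrite lerBrDl ltrBlDl.
Qed.

Lemma dcubeE k x y : cube a l y ->
  dcube k x y <-> forall i, (i < n)%N -> dindex k y i = dindex k x i.
Proof.
move=> Qy; split=> h i ni; have /andP[ay _] := Qy i ni.
  by apply/eqP; rewrite -coord_itvE//; exact: h.
by rewrite coord_itvE// h.
Qed.

Lemma dindex_lt k x i : cube a l x -> (i < n)%N -> (dindex k x i < 2 ^ k)%N.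
Proof.
move=> Qx ni; have /andP[ax xa] := Qx i ni.
rewrite /dindex truncn_lt_nat; last by rewrite divr_ge0 ?subr_ge0// ltW.
rewrite ltr_pdivrMr// natrX mulrCA divff ?expf_neq0// mulr1.
by rewrite ltrBlDl.
Qed.

Lemma sub_cube_dyadic k (j : nat -> nat) :
  (forall i, (i < n)%N -> (j i < 2 ^ k)%N) ->
  cube (n := n) (fun i => a i + (j i)%:R * (l / 2 ^+ k)) (l / 2 ^+ k)
    `<=` cube a l.
Proof.
move=> jk y yQ i ni; have /andP[h1 h2] := yQ i ni.
apply/andP; split.
  by apply: le_trans h1; rewrite lerDl mulr_ge0// ltW.
apply: (lt_le_trans h2); rewrite -addrA lerD2l.
have -> : (j i)%:R * (l / 2 ^+ k) + l / 2 ^+ k = (j i).+1%:R * (l / 2 ^+ k).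
  by rewrite -[(j i).+1%:R]natr1 mulrDl mul1r.
rewrite mulrCA ger_pMr// ler_pdivrMr ?exprn_gt0// mul1r -natrX ler_nat.
exact: jk.
Qed.

Lemma dcube_sub k x : cube a l x -> dcube k x `<=` cube a l.
Proof. by move=> Qx; apply: sub_cube_dyadic => i; exact: dindex_lt. Qed.

Lemma dcube_self k x : cube a l x -> dcube k x x.
Proof. by move=> Qx; apply/dcubeE. Qed.

Lemma dcube_eq k x y : cube a l x -> dcube k x y -> dcube k y = dcube k x.
Proof.
move=> Qx xy; have Qy := dcube_sub Qx xy.
have /(dcubeE k x Qy) yx := xy.
apply/seteqP; split=> z zin i ni; first by rewrite -(yx i)//; exact: zin.
by rewrite (yx i)//; exact: zin.
Qed.

Lemma dindexS k x i : cube a l x -> (i < n)%N ->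
  dindex k x i = (dindex k.+1 x i %/ 2)%N.
Proof.
move=> Qx ni; have /andP[ax _] := Qx i ni.
have := coord_itvE k.+1 (dindex k.+1 x i) ax; rewrite eqxx => /andP[h1 h2].
apply/eqP; rewrite -coord_itvE//.
move: h1 h2; set J := dindex _ _ _; set s := l / 2 ^+ k.+1.
have -> : l / 2 ^+ k = 2 * s.
  by rewrite /s exprS; field; rewrite ?expf_neq0.
have s0 : 0 < s by exact: side_gt0.
(* With [J = 2 q + r] and [0 <= r <= 1], the interval number [J] of length [s] lies in the interval
   number [q] of length [2 s]. *)
rewrite {1 2}(divn_eq J 2) natrD natrM.
set q := (J %/ 2)%N%:R : R.
have : (J %% 2)%:R <= 1 :> R by rewrite lern1 -ltnS ltn_mod.
move: (J %% 2)%:R (ler0n R (J %% 2)) => r r0 r1.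
have rs0 : 0 <= r * s by rewrite mulr_ge0// ltW.
have rs1 : r * s <= s by rewrite ler_piMl// ltW.
clearbody q s; clear -rs0 rs1; move: (a i) (Defs.coord x i) => u v.
by move=> ? ?; apply/andP; split; lra.
Qed.

Lemma dcube_anti k m x : cube a l x -> (k <= m)%N -> dcube m x `<=` dcube k x.
Proof.
move=> Qx /subnK <-; elim: (m - k)%N => // d IH y yin; apply: IH.
have Qy := dcube_sub Qx yin.
apply/dcubeE => // i ni; rewrite (dindexS _ Qx ni) (dindexS _ Qy ni).
by move/(dcubeE _ _ Qy) : yin => ->.
Qed.

Lemma dyadic_dcube k x : cube a l x -> dyadic a l (dcube k x).
Proof.
move=> Qx; exists k, (dindex k x); split => // i ni; exact: dindex_lt.
Qed.

Lemma dyadicP Q : dyadic a l Q -> exists k x, cube a l x /\ Q = dcube k x.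
Proof.
move=> [k [j [jk ->]]].
(* The chosen point is the lower corner, which belongs to the half-open cube. *)
have [x xE] := exists_coord n (fun i => a i + (j i)%:R * (l / 2 ^+ k)).
have xQ : cube (fun i => a i + (j i)%:R * (l / 2 ^+ k)) (l / 2 ^+ k) x.
  by move=> i ni; rewrite xE// lexx/= ltrDl.
exists k, x; have Qx := sub_cube_dyadic jk xQ; split => //.
have jE i : (i < n)%N -> dindex k x i = j i.
  move=> ni; apply/eqP; rewrite -coord_itvE; first exact: xQ.
  by have /andP[] := Qx i ni.
apply/seteqP; split=> z zin i ni; first by rewrite jE//; exact: zin.
by rewrite -(jE i)//; exact: zin.
Qed.

(** Only the first [n] indices matter, so a cube is coded by its generation and a finite list. *)
Lemma dyadic_countable : countable (dyadic (n := n) a l).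
Proof.
pose F (u : nat * seq nat) : set (Rn R n) :=
  cube (fun i => a i + (nth 0%N u.2 i)%:R * (l / 2 ^+ u.1)) (l / 2 ^+ u.1).
apply: (@sub_countable _ _ _ [set: nat * seq nat]); last exact: countableP.
apply: card_le_trans (card_image_le F _); apply: subset_card_le => _ [k [j [_ ->]]].
exists (k, mkseq j n) => //; rewrite /F /=.
by apply/seteqP; split=> z zin i ni; move: (zin i ni); rewrite nth_mkseq.
Qed.

Lemma lebn_dcube k x : lebn R n (dcube k x) = ((l / 2 ^+ k) ^+ n)%:E.
Proof. by rewrite lebn_cube// ltW. Qed.

Lemma dcube_measurable k x : measurable (dcube k x).
Proof. exact: cube_measurable. Qed.

Lemma vol_dcube k x : vol (dcube k x) = (l / 2 ^+ k) ^+ n.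
Proof. by rewrite /vol lebn_dcube. Qed.

Lemma vol_dcube_gt0 k x : 0 < vol (dcube k x).
Proof. by rewrite vol_dcube exprn_gt0. Qed.

(** Volume thus determines the generation; in dimension 0 every cube would have volume 1. *)
Lemma ltr_vol_dcube k m x y : (0 < n)%N ->
  (vol (dcube m y) < vol (dcube k x)) = (k < m)%N.
Proof.
move=> n0; rewrite !vol_dcube ltr_pXn2r ?nnegrE ?ltW//.
by rewrite ltr_pM2l// ltf_pV2 ?posrE ?exprn_gt0// ltr_eXn2l// ltr1n.
Qed.

Lemma dyadic_measurable : dyadic (n := n) a l `<=` measurable.
Proof. by move=> _ [k [j [_ ->]]]; exact: cube_measurable. Qed.

Lemma dyadic_sub : forall Q, dyadic (n := n) a l Q -> Q `<=` cube a l.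
Proof. by move=> _ [k [j [jk ->]]]; exact: sub_cube_dyadic. Qed.

Lemma lebn_dyadic Q : dyadic a l Q -> lebn R n Q = (vol Q)%:E.
Proof. by move=> /dyadicP[k [x [_ ->]]]; rewrite vol_dcube lebn_dcube. Qed.

Lemma vol_dyadic_gt0 Q : dyadic (n := n) a l Q -> 0 < vol Q.
Proof. by move=> /dyadicP[k [x [_ ->]]]; exact: vol_dcube_gt0. Qed.

End dyadic_cubes.

(** * Stopping-time selection of cubes *)

Section stopping_cubes.
Context (R : realType) (n : nat) (a : nat -> R) (l : R).
Variables (w : set (Rn R n) -> R) (c : R).
Hypotheses (l0 : 0 < l) (n0 : (0 < n)%N) (w0 : forall Q, 0 <= w Q).
Hypothesis c1 : 1 <= c.
Implicit Types x y : Rn R n.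
Local Notation dcube := (dcube a l).

(* The value of [w] at the smallest stopping cube containing [dcube k x]. *)
Fixpoint stopping_value k x : R :=
  if k is k'.+1 then
    if c * stopping_value k' x < w (dcube k x) then w (dcube k x)
    else stopping_value k' x
  else w (dcube 0 x).

Definition stops k x : bool :=
  if k is k'.+1 then c * stopping_value k' x < w (dcube k x) else true.

Definition stopping : set (set (Rn R n)) :=
  [set Q | exists k x, [/\ cube a l x, stops k x & Q = dcube k x]].

Lemma stopping_valueS k x : stopping_value k.+1 x =
  if stops k.+1 x then w (dcube k.+1 x) else stopping_value k x.
Proof. by []. Qed.

Lemma stopping_value_stops k x : stops k x -> stopping_value k x = w (dcube k x).
Proof. by case: k => //= k ->. Qed.

(** Points of [dcube k x] share all their ancestors of generation at most [k]. *)
Lemma stopping_value_local k x y : cube a l x -> dcube k x y ->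
  stopping_value k y = stopping_value k x.
Proof.
move=> Qx; elim: k => [|k IH] xy /=; first by rewrite (dcube_eq l0 Qx xy).
by rewrite (dcube_eq l0 Qx xy) IH//; exact: dcube_anti xy.
Qed.

Lemma stops_local k x y : cube a l x -> dcube k x y -> stops k y = stops k x.
Proof.
move=> Qx; case: k => [|k] xy //=.
rewrite (dcube_eq l0 Qx xy) (@stopping_value_local k x)//.
exact: dcube_anti xy.
Qed.

(** At a stopping cube the value is [w] itself and [1 <= c]; elsewhere the failed test is the
    inequality. *)
Lemma le_stopping_value k x : w (dcube k x) <= c * stopping_value k x.
Proof.
have cw Q : w Q <= c * w Q by rewrite ler_peMl.
case: k => [|k] /=; first exact: cw.
by case: ltP.
Qed.

Lemma stopping_value_attained k x :
  exists2 m, (m <= k)%N /\ stops m x & stopping_value k x = w (dcube m x).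
Proof.
elim: k => [|k [m [mk sm] tm]]; first by exists 0%N.
rewrite stopping_valueS; case: ifPn => s; first by exists k.+1.
by exists m => //; split => //; exact: leqW.
Qed.

Lemma stopping_value_const k m x : (k <= m)%N ->
  (forall i, (k < i <= m)%N -> ~~ stops i x) ->
  stopping_value m x = stopping_value k x.
Proof.
move=> /subnK <-; elim: (m - k)%N => // d IH ns.
rewrite addSn stopping_valueS (negbTE (ns _ _)); last first.
  by rewrite leqnn andbT ltnS leq_addl.
apply: IH => i /andP[ki id]; apply: ns; rewrite ki/=; exact: leqW.
Qed.

Lemma stopping_dyadic : stopping `<=` dyadic a l.
Proof. by move=> _ [k [x [Qx _ ->]]]; exact: dyadic_dcube. Qed.

Lemma stopping_countable : countable stopping.
Proof.
apply: sub_countable (dyadic_countable n a l).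
exact/subset_card_le/stopping_dyadic.
Qed.

(** [P] is the ancestor of [Q], possibly [Q] itself, at which the stopping value of [Q] is
    attained. *)
Lemma dyadic_le_stopping Q x : dyadic a l Q -> Q x ->
  exists P, [/\ stopping P, P x & w Q <= c * w P].
Proof.
move=> dQ Qx; have Q0x : cube a l x by exact: dyadic_sub Qx.
have [k [y [Q0y QE]]] := dyadicP l0 dQ.
have {}QE : Q = dcube k x by rewrite QE (dcube_eq l0 Q0y)// -QE.
have [m [mk sm] tm] := stopping_value_attained k x.
exists (dcube m x); split; first by exists m, x.
- exact: dcube_self.
- by rewrite QE -tm le_stopping_value.
Qed.

(** The points of [Q] in no smaller stopping cube. Sparsity asks for a function of the set [Q], so
    its generation is read off from its volume. *)
Definition stopping_core (Q : set (Rn R n)) : set (Rn R n) :=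
  Q `&` [set y | forall m, vol (dcube m y) < vol Q -> ~~ stops m y].

(** At a common point [y] both cubes have the form [dcube _ y]; the smaller one would be a stopping
    cube that the core of the larger excludes. *)
Lemma stopping_core_disjoint Q Q' : stopping Q -> stopping Q' -> Q <> Q' ->
  stopping_core Q `&` stopping_core Q' = set0.
Proof.
move=> [k [x [Qx sx QE]]] [k' [x' [Qx' sx' QE']]] QQ'.
apply/seteqP; split=> // y [[Qy yn] [Qy' yn']]; apply: QQ'.
rewrite QE in Qy; rewrite QE' in Qy'.
have Q0y : cube a l y by exact: dcube_sub Qy.
rewrite -(stops_local Qx Qy) in sx; rewrite -(stops_local Qx' Qy') in sx'.
rewrite -(dcube_eq l0 Qx Qy) in QE; rewrite -(dcube_eq l0 Qx' Qy') in QE'.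
rewrite QE QE'; case: (ltngtP k k') => [kk'|kk'|-> //].
- have := yn k'; rewrite QE ltr_vol_dcube// kk' sx' => /(_ isT) //.
- have := yn' k; rewrite QE' ltr_vol_dcube// kk' sx => /(_ isT) //.
Qed.

(** [m] is the first stopping generation after [k] along [y], so these are the maximal later
    stopping cubes inside [dcube k x]. *)
Definition stopping_children k x : set (set (Rn R n)) :=
  [set P | exists m y, [/\ dcube k x y, (k < m)%N, stops m y,
     forall i, (k < i < m)%N -> ~~ stops i y & P = dcube m y]].

Lemma stopping_core_dcube k x : cube a l x ->
  stopping_core (dcube k x) =
  dcube k x `\` \bigcup_(P in stopping_children k x) P.
Proof.
move=> Qx; apply/seteqP; split=> y [xy yn]; split => //.
  move=> [_ [m [z [xz km sm _ ->]]] zy].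
  have Qz := dcube_sub l0 Qx xz.
  have := yn m; rewrite ltr_vol_dcube// km (stops_local Qz zy) sm => /(_ isT) //.
move=> m; rewrite ltr_vol_dcube// => km; apply/negP => sm.
have Qy := dcube_sub l0 Qx xy.
(* The least stopping generation after [k] gives a child containing [y]. *)
have exm : exists m, (k < m)%N && stops m y by exists m; rewrite km.
case: (ex_minnP exm) => i /andP[ki si] imin.
apply: yn; exists (dcube i y); last exact: dcube_self.
exists i, y; split => // j /andP[kj ji]; apply/negP => sj.
by have := imin j; rewrite kj sj => /(_ isT); rewrite leqNgt ji.
Qed.

(** Seen from a common point, both generations are the first to stop after [k], hence equal. *)
Lemma stopping_children_disjoint k x P P' : cube a l x ->
  stopping_children k x P -> stopping_children k x P' ->
  P `&` P' !=set0 -> P = P'.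
Proof.
move=> Qx [m [y [xy km sy my PE]]] [m' [y' [xy' km' sy' my' PE']]] [z []].
rewrite PE PE' => yz yz'.
have Qy := dcube_sub l0 Qx xy; have Qy' := dcube_sub l0 Qx xy'.
have sz i : (i <= m)%N -> stops i z = stops i y.
  by move=> im; apply: stops_local => //; exact: dcube_anti yz.
have sz' i : (i <= m')%N -> stops i z = stops i y'.
  by move=> im; apply: stops_local => //; exact: dcube_anti yz'.
rewrite -(dcube_eq l0 Qy yz) -(dcube_eq l0 Qy' yz').
case: (ltngtP m m') => [mm'|mm'|-> //].
- have := my' m; rewrite km mm' -sz' ?(ltnW mm')// sz// sy => /(_ isT) //.
- have := my m'; rewrite km' mm' -sz ?(ltnW mm')// sz'// sy' => /(_ isT) //.
Qed.

(** No stop occurs strictly between the two generations, so the test passed by [P] still compares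
    with [w (dcube k x)]. *)
Lemma stopping_children_gt k x P : cube a l x -> stops k x ->
  stopping_children k x P -> c * w (dcube k x) < w P.
Proof.
move=> Qx sx [[|m] [y [xy //= km sy my ->]]].
have yE : stopping_value m y = w (dcube k x).
  rewrite (@stopping_value_const k)//.
  by rewrite (stopping_value_local Qx xy) stopping_value_stops.
by rewrite -yE.
Qed.

Lemma stopping_children_dyadic k x P : cube a l x -> stopping_children k x P ->
  dyadic a l P /\ P `<=` dcube k x.
Proof.
move=> Qx [m [y [xy km _ _ ->]]]; have Qy := dcube_sub l0 Qx xy.
split; first exact: dyadic_dcube.
by rewrite -(dcube_eq l0 Qx xy); apply: dcube_anti => //; exact: ltnW.
Qed.

End stopping_cubes.

(** * Sparseness of the stopping family *)

Lemma half_le_of_decomposition (R : realType) (v : R) (x y : \bar R) :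
  (0 <= x)%E -> (0 <= y)%E -> (v%:E = x + y)%E -> (y <= (v / 2)%:E)%E ->
  ((v / 2)%:E <= x)%E.
Proof.
case: x => [x| |]//; case: y => [y| |]// _ _ [->].
by rewrite !lee_fin => ?; lra.
Qed.

Lemma intabs_ge0 (R : realType) (n : nat) (f : Rn R n -> R) Q : 0 <= intabs f Q.
Proof. by rewrite fine_ge0// integral_ge0// => x _; rewrite lee_fin. Qed.

Section integrable_on_cube.
Context (R : realType) (n : nat) (a : nat -> R) (l : R) (f : Rn R n -> R).
Hypothesis intf : (lebn R n).-integrable (cube a l) (EFin \o f).

Lemma measurable_norm_cube : measurable_fun (cube a l) (fun x => `|f x|%:E).
Proof.
have /integrableP[mf _] := intf.
exact: measurableT_comp (@abse_measurable _ _) mf.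
Qed.

(** Integrability makes the integral finite, so [fine] does not fall back on its default value. *)
Lemma EFin_intabs Q : measurable Q -> Q `<=` cube a l ->
  (intabs f Q)%:E = (\int[lebn R n]_(x in Q) `|f x|%:E)%E.
Proof.
move=> mQ QQ0; rewrite /intabs fineK// ge0_fin_numE; last first.
  by apply: integral_ge0 => x _; rewrite lee_fin.
have /integrableP[_] := intf; apply: le_lt_trans.
apply: ge0_subset_integral => //; first exact: cube_measurable.
exact: measurable_norm_cube.
Qed.

Lemma intabs_le Q Q' : measurable Q -> measurable Q' -> Q' `<=` cube a l ->
  Q `<=` Q' -> intabs f Q <= intabs f Q'.
Proof.
move=> mQ mQ' Q'Q0 QQ'; rewrite -lee_fin !EFin_intabs//; last first.
  exact: subset_trans QQ' _.
apply: ge0_subset_integral => //.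
by apply: measurable_funS measurable_norm_cube => //; exact: cube_measurable.
Qed.

Section sparse.
Variables (phi : R -> R) (K : R).
Hypotheses (l0 : 0 < l) (n0 : (0 < n)%N) (K1 : 1 <= K).
Hypothesis phi_gt0 : forall v, 0 < v -> 0 < phi v.
Hypothesis phi_le : forall u v, 0 < u -> u <= v -> u * phi u <= K * (v * phi v).

Let w (Q : set (Rn R n)) := phi (vol Q) * intabs f Q.

(* A child [P] of [Q] has [2 K phi(|Q|) int_Q |f| < phi(|P|) int_P |f|];
   [phi_le] turns this into [2 |P| int_Q |f| <= |Q| int_P |f|]. *)
Lemma stopping_children_intabs k x P : cube a l x -> stops a l w (2 * K) k x ->
  stopping_children a l w (2 * K) k x P ->
  0 < intabs f (dcube a l k x) /\
  2 * vol P * intabs f (dcube a l k x) <= vol (dcube a l k x) * intabs f P.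
Proof.
move=> Qx sx chP; have lt := stopping_children_gt l0 Qx sx chP.
have [dP PQ] := stopping_children_dyadic l0 Qx chP.
have mQ := dcube_measurable a l k x; have mP := dyadic_measurable dP.
have IPQ : intabs f P <= intabs f (dcube a l k x).
  by apply: intabs_le => //; exact: dcube_sub.
have vQ0 := vol_dcube_gt0 a l0 k x.
have dQ := dyadic_dcube l0 k Qx.
have vP0 : 0 < vol P by exact: vol_dyadic_gt0 dP.
have vPQ : vol P <= vol (dcube a l k x).
  by rewrite -lee_fin -!(@lebn_dyadic R n a l)// le_measure// inE.
have := phi_le vP0 vPQ; have pQ := phi_gt0 vQ0; have pP := phi_gt0 vP0.
move: lt; rewrite /w; set I := intabs f (dcube a l k x) in IPQ *.
have I0 : 0 <= I := intabs_ge0 _ _; have J0 := intabs_ge0 f P.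
clearbody I; move: pQ pP vP0 vQ0 IPQ J0.
move: (phi (vol P)) (phi (vol (dcube a l k x))) => p p'.
move: (vol P) (vol (dcube a l k x)) (intabs f P) => v v' J.
move=> p'0 p0 v0 v'0 JI J0 h1 h2.
(* Otherwise both integrals vanish and the strict inequality [h1] reads [0 < 0]. *)
have Igt0 : 0 < I.
  rewrite lt_neqAle I0 andbT; apply/eqP => IE.
  have J0' : J = 0 by apply/eqP; rewrite eq_le J0 andbT IE.
  by move: h1; rewrite -IE J0' !mulr0 ltxx.
split => //.
(* After multiplication by [K * p'], the stopping inequality [h1] and then the growth bound [h2]
   apply. *)
have K0 : 0 < K * p' by rewrite mulr_gt0// (lt_le_trans ltr01).
rewrite -(ler_pM2l K0).
apply: (@le_trans _ _ (v * (p * J))).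
  rewrite (_ : K * p' * _ = v * (2 * K * (p' * I))); last by ring.
  by rewrite ler_pM2l// ltW.
rewrite mulrA (_ : K * p' * _ = K * (v' * p') * J); last by ring.
by rewrite ler_wpM2r.
Qed.

(** Summing the previous inequality over the disjoint children, whose integrals add up to at most
    that over the parent, leaves half of the parent's volume. *)
Lemma stopping_children_measure k x : cube a l x -> stops a l w (2 * K) k x ->
  (lebn R n (\bigcup_(P in stopping_children a l w (2 * K) k x) P)
    <= (vol (dcube a l k x) / 2)%:E)%E.
Proof.
move=> Qx sx; set F := stopping_children _ _ _ _ _ _; set Q := dcube _ _ _ _.
have vQ0 : 0 < vol Q by exact: vol_dcube_gt0.
have QQ0 : Q `<=` cube a l by exact: dcube_sub.
have Fd : F `<=` dyadic a l by move=> P /stopping_children_dyadic-/(_ l0 Qx)[].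
have Fm : F `<=` measurable by move=> P /Fd; exact: dyadic_measurable.
have cF : countable F.
  by apply: sub_countable (dyadic_countable n a l); exact: subset_card_le.
have FQ : \bigcup_(P in F) P `<=` Q.
  by apply: bigcup_sub => P /stopping_children_dyadic-/(_ l0 Qx)[].
have mU : measurable (\bigcup_(P in F) P) by exact: countable_bigcup_measurable.
(* Positivity of the integral over [Q], needed for the division in [C], comes from the existence of
   a child. *)
have [/eqP F0|/set0P[P0 FP0]] := boolP (F == set0).
  by rewrite F0 bigcup_set0 measure0 lee_fin divr_ge0// ltW.
have [I0 _] := stopping_children_intabs Qx sx FP0.
(* With this constant the volume of each child is at most its integral of [C |f|], and the integral
   of [C |f|] over [Q] is half the volume of [Q]. *)
pose C := vol Q / (2 * intabs f Q).
have C0 : 0 <= C by rewrite divr_ge0 ?mulr_ge0 ?ltW.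
have mf A : measurable A -> A `<=` Q -> measurable_fun A (fun x => `|f x|%:E).
  move=> mA AQ; apply: measurable_funS measurable_norm_cube.
    exact: cube_measurable.
  exact: subset_trans QQ0.
have mCf A : measurable A -> A `<=` Q ->
    (\int[lebn R n]_(x in A) (C%:E * `|f x|%:E) = (C * intabs f A)%:E)%E.
  move=> mA AQ; have mfA := mf A mA AQ.
  rewrite (EFinM C) EFin_intabs//; last exact: subset_trans QQ0.
  by rewrite ge0_integralZl ?lee_fin.
apply: (@le_trans _ _
    (\int[lebn R n]_(x in \bigcup_(P in F) P) (C%:E * `|f x|%:E))%E).
  apply: bigcup_measure_le_integral => //.
  - by move=> P P' FP FP'; exact: stopping_children_disjoint Qx FP FP'.
  - by apply: measurable_funeM; exact: mf.
  - by move=> y _; rewrite mule_ge0// lee_fin.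
  - move=> P FP; have [dP PQ] := stopping_children_dyadic l0 Qx FP.
  rewrite mCf//; last exact: Fm.
  apply: (@le_trans _ _ (vol P)%:E); first by rewrite -(lebn_dyadic l0 dP).
  rewrite lee_fin /C mulrAC ler_pdivlMr ?mulr_gt0//.
  have [_] := stopping_children_intabs Qx sx FP.
  by rewrite mulrCA mulrA.
rewrite mCf// lee_fin /C mulrAC ler_pdivrMr ?mulr_gt0// -/Q.
rewrite (_ : vol Q / 2 * _ = vol Q * intabs f Q); last by field.
by rewrite ler_pM2l//; apply: intabs_le => //; exact: dcube_measurable.
Qed.

(** The core is what the children leave of a selected cube, hence at least half of it. *)
Lemma sparse_stopping : sparse a l (stopping a l w (2 * K)).
Proof.
split; [exact: stopping_dyadic|exact: stopping_countable|].
exists (stopping_core a l w (2 * K)); split; last exact: stopping_core_disjoint.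
move=> _ [k [x [Qx sx ->]]].
have mQ := dcube_measurable a l k x.
have mB : measurable (\bigcup_(P in stopping_children a l w (2 * K) k x) P).
  have Fd : stopping_children a l w (2 * K) k x `<=` dyadic a l.
    by move=> P /stopping_children_dyadic-/(_ l0 Qx)[].
  apply: countable_bigcup_measurable; last by move=> P /Fd; exact: dyadic_measurable.
  by apply: sub_countable (dyadic_countable n a l); exact: subset_card_le.
have mE : measurable (stopping_core a l w (2 * K) (dcube a l k x)).
  by rewrite stopping_core_dcube//; exact: measurableD.
split => //; first by move=> y [].
have vE : lebn R n (dcube a l k x) = (vol (dcube a l k x))%:E.
  by exact/(lebn_dyadic l0)/dyadic_dcube.
have eqv : ((vol (dcube a l k x))%:E =
    lebn R n (stopping_core a l w (2 * K) (dcube a l k x)) +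
    lebn R n (dcube a l k x `&`
      \bigcup_(P in stopping_children a l w (2 * K) k x) P))%E.
  by rewrite -vE stopping_core_dcube//; exact: measureDI.
rewrite vE.
have h : (lebn R n (dcube a l k x `&`
    \bigcup_(P in stopping_children a l w (2 * K) k x) P) <=
    (vol (dcube a l k x) / 2)%:E)%E.
  apply: le_trans (stopping_children_measure Qx sx).
  by apply: le_measure; rewrite ?inE//; exact: measurableI.
rewrite inver pnatr_eq0/= -EFinM.
by apply: half_le_of_decomposition eqv h; exact: measure_ge0.
Qed.

End sparse.
End integrable_on_cube.

(** * Comparison of the two norms *)

Lemma le_poweR (R : realType) (r : R) (x y : \bar R) : 0 <= r ->
  (0 <= x)%E -> (x <= y)%E -> (x `^ r <= y `^ r)%E.
Proof.
move=> r0 x0 xy; apply: gt0_ler_poweR => //; rewrite in_itv/= leey andbT//.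
exact: le_trans xy.
Qed.

Section maximal_function.
Context (R : realType) (n : nat) (p q alpha : R) (a : nat -> R) (l : R).
Variable f : Rn R n -> R.
Hypotheses (n0 : (0 < n)%N) (q0 : 0 < q) (l0 : 0 < l).
Hypothesis intf : (lebn R n).-integrable (cube a l) (EFin \o f).

(** The exponent is [lambda / n - 1] at [lambda = n (1/p - 1/q)]; thus [v * weight v] carries the
    exponent [1/p - 1/q], nonnegative when [0 < p <= q]. *)
Definition weight (v : R) : R :=
  v `^ (p^-1 - q^-1 - 1) * (1 - Order.min (ln v) 0) `^ alpha.

Definition weighted_mean (Q : set (Rn R n)) : R := weight (vol Q) * intabs f Q.

Local Notation w := weighted_mean.
Local Notation M := (Mmax (n%:R * (p^-1 - q^-1)) alpha a l f).

Lemma weighted_mean_ge0 Q : 0 <= w Q.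
Proof. by rewrite !mulr_ge0 ?powR_ge0 ?intabs_ge0. Qed.

Lemma MmaxE x :
  M x = ereal_sup [set (w Q)%:E | Q in [set Q | dyadic a l Q /\ Q x]].
Proof.
by rewrite /Mmax mulrAC divff ?pnatr_eq0 -?lt0n// mul1r.
Qed.

Lemma Mmax_ge0 x : cube a l x -> (0 <= M x)%E.
Proof.
move=> Qx; rewrite MmaxE; apply: (@le_trans _ _ (w (dcube a l 0 x))%:E).
  by rewrite lee_fin weighted_mean_ge0.
apply: ereal_sup_ubound; exists (dcube a l 0 x) => //; split.
  exact: dyadic_dcube.
exact: dcube_self.
Qed.

Lemma measurable_Mmax_poweR : measurable_fun (cube a l) (fun x => M x `^ q)%E.
Proof.
apply: measurableT_comp (measurable_poweR q) _.
rewrite (funext MmaxE).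
apply: measurable_fun_ereal_sup_mem; first exact: dyadic_countable.
exact: dyadic_measurable.
Qed.

(** The exponent [-(1 - 1/p)] exceeds that of [weight] by [1/q], and this surplus becomes [vol Q]
    under the power [q]. *)
Lemma SR_termE Q : 0 < vol Q ->
  (logw Q `^ alpha * vol Q `^ (- (1 - p^-1)) * intabs f Q) `^ q =
  w Q `^ q * vol Q.
Proof.
move=> v0; have -> : - (1 - p^-1) = p^-1 - q^-1 - 1 + q^-1 by ring.
rewrite [vol Q `^ _]powRD; last by rewrite (gt_eqF v0) implybT.
rewrite (_ : logw Q `^ alpha * _ * _ = w Q * vol Q `^ q^-1); last first.
  by rewrite /w /weight /logw; ring.
rewrite powRM ?powR_ge0 ?weighted_mean_ge0// -powRrM mulVf ?gt_eqF//.
by rewrite powRr1// ltW.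
Qed.

Lemma SRnorm_le_Lqnorm C : 2 `^ q^-1 <= C ->
  (SRnorm p q alpha a l f <= C%:E * Lqnorm q a l M)%E.
Proof.
move=> C2; apply: ge_ereal_sup => _ [S [Sd cS [E [Emeas Edisj]]] <-].
have mM := measurable_Mmax_poweR.
have qV0 : 0 <= q^-1 by rewrite invr_ge0 ltW.
have int0 : (0 <= \int[lebn R n]_(x in cube a l) (M x `^ q))%E.
  by apply: integral_ge0 => x _; exact: poweR_ge0.
(* The factor 2 is the loss from replacing the volume of [Q] by that of [E Q]; its [q]-th root is
   absorbed by [C]. *)
apply: (@le_trans _ _
    ((2%:E * \int[lebn R n]_(x in cube a l) (M x `^ q)) `^ q^-1)%E); last first.
  rewrite poweRM// poweR_EFin /Lqnorm; apply: lee_wpmul2r; rewrite ?lee_fin//.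
  exact: poweR_ge0.
apply: le_poweR => //.
  by apply: esum_ge0 => Q _; rewrite lee_fin powR_ge0.
rewrite -ge0_integralZl//; last 2 first.
- exact: cube_measurable.
- by move=> x _; exact: poweR_ge0.
apply: (@le_trans _ _
    (\esum_(Q in S) ((2 * w Q `^ q)%:E * lebn R n (E Q))%E)).
  apply: le_esum => Q SQ; have dQ := Sd Q SQ.
  rewrite SR_termE; last exact: vol_dyadic_gt0 dQ.
  have [_ _] := Emeas Q SQ; rewrite (lebn_dyadic l0 dQ) inver pnatr_eq0/=.
  rewrite -EFinM => EQ.
  apply: (@le_trans _ _ ((2 * w Q `^ q)%:E * (vol Q / 2)%:E)%E).
    by rewrite -EFinM lee_fin le_eqVlt; apply/orP; left; apply/eqP; field.
  by apply: lee_wpmul2l => //; rewrite lee_fin mulr_ge0 ?powR_ge0.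
apply: esum_sparse_le_integral => //.
- by move=> Q SQ; have [] := Emeas Q SQ.
- move=> Q SQ; have [_ EQ _] := Emeas Q SQ.
  exact: subset_trans EQ (dyadic_sub l0 (Sd Q SQ)).
- exact: cube_measurable.
- exact: measurable_funeM.
- by move=> x _; rewrite mule_ge0 ?lee_fin// poweR_ge0.
- by move=> Q; rewrite mulr_ge0 ?powR_ge0.
move=> Q x SQ Ex; have [_ EQ _] := Emeas Q SQ.
rewrite EFinM; apply: lee_wpmul2l; rewrite ?lee_fin//.
rewrite -poweR_EFin; apply: le_poweR; rewrite ?lee_fin ?weighted_mean_ge0 ?(ltW q0)//.
rewrite MmaxE; apply: ereal_sup_ubound; exists Q => //.
by split; [exact: Sd|exact: EQ].
Qed.

Variable K : R.
Hypothesis K1 : 1 <= K.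
Hypothesis weight_le : forall u v, 0 < u -> u <= v ->
  u * weight u <= K * (v * weight v).

Lemma weight_gt0 v : 0 < v -> 0 < weight v.
Proof.
move=> v0; rewrite mulr_gt0// powR_gt0// (lt_le_trans ltr01)//.
exact: one_sub_min_ln_ge1.
Qed.

Lemma Lqnorm_le_SRnorm :
  (Lqnorm q a l M <= (2 * K)%:E * SRnorm p q alpha a l f)%E.
Proof.
pose c := 2 * K; have c1 : 1 <= c.
  by apply: (le_trans K1); rewrite ler_peMl ?ler1n// (le_trans ler01).
have c0 : 0 < c by exact: lt_le_trans c1.
have spS := sparse_stopping intf l0 n0 K1 weight_gt0 weight_le.
set S := stopping _ _ _ _ in spS.
have Sd : S `<=` dyadic a l by case: spS.
have qV0 : 0 <= q^-1 by rewrite invr_ge0 ltW.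
have mM := measurable_Mmax_poweR.
pose SS := (\esum_(Q in S) (w Q `^ q * vol Q)%:E)%E.
have SS0 : (0 <= SS)%E.
  apply: esum_ge0 => Q SQ; rewrite lee_fin mulr_ge0 ?powR_ge0// ltW//.
  exact: vol_dyadic_gt0 (Sd _ SQ).
have SSle : (SS `^ q^-1 <= SRnorm p q alpha a l f)%E.
  apply: ereal_sup_ubound; exists S => //; congr (_ `^ _)%E.
  apply: eq_esum => Q SQ; rewrite SR_termE//.
  exact: vol_dyadic_gt0 (Sd _ SQ).
have cq0 : 0 < c `^ q by rewrite powR_gt0.
have Mle x : cube a l x -> (M x `^ q <= (c `^ q)%:E *
    ereal_sup [set (w Q `^ q)%:E | Q in [set Q | S Q /\ Q x]])%E.
  move=> Qx; set L := ereal_sup _.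
  have wL Q : S Q -> Q x -> ((w Q `^ q)%:E <= L)%E.
    by move=> SQ xQ; apply: ereal_sup_ubound; exists Q.
  (* Some stopping cube contains [x], so [L] is not the supremum of an empty set, which would be
     [-oo]. *)
  have [P0 [SP0 P0x _]] := dyadic_le_stopping l0 (weighted_mean_ge0)
    c1 (dyadic_dcube l0 0 Qx) (dcube_self l0 0 Qx).
  have L0 : (0 <= L)%E.
    by apply: le_trans (wL _ SP0 P0x); rewrite lee_fin powR_ge0.
  (* [L] is a supremum of [q]-th powers; pulling the power out reduces the claim to the pointwise
     bound of [M x] by [c] times the root of [L]. *)
  have -> : ((c `^ q)%:E * L = (c%:E * L `^ q^-1) `^ q)%E.
    rewrite poweRM ?lee_fin ?(ltW c0) ?poweR_ge0// -poweRrM mulVf ?gt_eqF//.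
    by rewrite poweRe1.
  apply: le_poweR; rewrite ?(ltW q0) ?Mmax_ge0//.
  rewrite MmaxE; apply: ge_ereal_sup => _ [Q [dQ xQ] <-].
  have [P [SP Px wQP]] := dyadic_le_stopping l0 weighted_mean_ge0 c1 dQ xQ.
  apply: (@le_trans _ _ (c%:E * (w P)%:E)%E); first by rewrite -EFinM lee_fin.
  apply: lee_wpmul2l; rewrite ?lee_fin ?(ltW c0)//.
  have -> : (w P)%:E = ((w P `^ q)%:E `^ q^-1)%E.
    by rewrite poweR_EFin -powRrM mulfV ?gt_eqF// powRr1// weighted_mean_ge0.
  apply: le_poweR => //; first by rewrite lee_fin powR_ge0.
  exact: wL.
have intle : (\int[lebn R n]_(x in cube a l) (M x `^ q) <= (c `^ q)%:E * SS)%E.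
  (* Dividing by [c ^ q] first lets [integral_le_esum] apply with [h Q] equal to the [q]-th power of
     [w Q]. *)
  rewrite muleC -lee_pdivrMr// muleC -ge0_integralZl//; last 3 first.
  - exact: cube_measurable.
  - by move=> x _; exact: poweR_ge0.
  - by rewrite lee_fin invr_ge0 ltW.
  apply: (@le_trans _ _ (\esum_(Q in S) ((w Q `^ q)%:E * lebn R n Q))%E).
    apply: integral_le_esum.
    - exact: stopping_countable.
    - by move=> Q /Sd; exact: dyadic_measurable.
    - by move=> Q /Sd; exact: dyadic_sub.
    - exact: cube_measurable.
    - exact: measurable_funeM.
    - by move=> x _; rewrite mule_ge0 ?poweR_ge0// lee_fin invr_ge0 ltW.
    - by move=> Q; exact: powR_ge0.
    by move=> x /Mle; rewrite muleC -lee_pdivrMr// muleC.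
  apply: le_esum => Q SQ.
  by rewrite (lebn_dyadic l0 (Sd Q SQ)).
apply: (@le_trans _ _ (((c `^ q)%:E * SS) `^ q^-1)%E).
  apply: le_poweR => //.
  by apply: integral_ge0 => x _; exact: poweR_ge0.
rewrite poweRM// ?lee_fin ?powR_ge0// poweR_EFin -powRrM mulfV ?gt_eqF//.
rewrite powRr1 ?(ltW c0)//; apply: lee_wpmul2l => //.
by rewrite lee_fin ltW.
Qed.

End maximal_function.

Theorem theorem3p1 (R : realType) (n : nat) (p q alpha : R) :
  (1 <= n)%N -> 1 <= p -> p <= q -> (p = q -> alpha <= 0) ->
  exists C : R, 0 < C /\
    forall (a : nat -> R) (l : R), 0 < l ->
    forall f : Rn R n -> R,
      (lebn R n).-integrable (cube a l) (EFin \o f) ->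
      (SRnorm p q alpha a l f
         <= C%:E * Lqnorm q a l (Mmax (n%:R * (p^-1 - q^-1)) alpha a l f))%E /\
      (Lqnorm q a l (Mmax (n%:R * (p^-1 - q^-1)) alpha a l f)
         <= C%:E * SRnorm p q alpha a l f)%E.
Proof.
move=> n0 p1 pq pqal.
have p0 : 0 < p by exact: lt_le_trans p1.
have q0 : 0 < q by exact: lt_le_trans pq.
have q1 : 1 <= q by exact: le_trans pq.
have s0 : 0 <= p^-1 - q^-1 by rewrite subr_ge0 lef_pV2.
have sal : p^-1 - q^-1 = 0 -> alpha <= 0.
  by move=> /subr0_eq/invr_inj; exact: pqal.
have [K [K1 HK]] := powR_log_almost_increasing s0 sal.
have weight_le u v : 0 < u -> u <= v ->
    u * weight p q alpha u <= K * (v * weight p q alpha v).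
  have E t : 0 < t -> t * weight p q alpha t =
      t `^ (p^-1 - q^-1) * (1 - Order.min (ln t) 0) `^ alpha.
    move=> t0; rewrite /weight mulrA; congr (_ * _).
    rewrite [t `^ (_ - 1)]powRB ?(gt_eqF t0) ?implybT// powRr1 ?ltW//.
    by field; rewrite gt_eqF.
  move=> u0 uv; rewrite !E//; first exact: HK.
  exact: lt_le_trans uv.
exists (2 * K); split; first by rewrite mulr_gt0// (lt_le_trans ltr01).
move=> a l l0 f intf; split; last exact: Lqnorm_le_SRnorm.
apply: SRnorm_le_Lqnorm => //.
(* Since [1 <= q], the root [2 ^ (1/q)] is at most 2, so the single constant [2 * K] serves both
   inequalities. *)
apply: (@le_trans _ _ 2); last by rewrite ler_peMr.
by rewrite ler1_powR ?ler1n// invf_le1.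
Qed.
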